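(* Let $R$ be an associative ring with identity and let $\mathcal{X}$ be a precovering class of left $R$-modules closed under isomorphisms, finite direct sums and direct summands. The following conditions are equivalent for a left $R$-module $M$: (1) $M$ is (isomorphic to) a pure submodule of a module in $\mathcal{X}$. (2) Every pure-injective left $R$-module belongs to $\mathcal{X}^{-1}(M)$. (3) $PE(M)\in\mathcal{X}^{-1}(M)$. (4) For any right $R$-module $N$, $N^+\in\mathcal{X}^{-1}(M)$. (5) For any pure-projective right $R$-module $P$, $P^+\in\mathcal{X}^{-1}(M)$.
   Context: Modules are unital left $R$-modules unless stated otherwise. $PE(M)$ denotes a pure-injective preenvelope of $M$, and $N^+=\mathrm{Hom}_{\mathbb{Z}}(N,\mathbb{Q}/\mathbb{Z})$ is the character module of $N$. For a class $\mathcal{X}$ of modules, an $\mathcal{X}$-precover of $N$ is a morphism $g:X\to N$ with $X\in\mathcal{X}$ such that $\mathrm{Hom}(X',X)\to\mathrm{Hom}(X',N)$ is surjective for every $X'\in\mathcal{X}$; preenvelopes are defined dually; $\mathcal{X}$ is precovering if every module has an $\mathcal{X}$-precover. The $\mathcal{X}$-precover completing domain $\mathcal{X}^{-1}(M)$ of a module $M$ is the class of all modules $N$ such that for every morphism $f:M\to N$ and every $\mathcal{X}$-precover $g:X\to N$ there is a morphism $h:M\to X$ with $gh=f$. *)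

(* Defs.v *)
From HB Require Import structures.
From mathcomp Require Import all_boot all_order all_algebra.
From mathcomp Require Import generic_quotient ring_quotient freeg.
From mathcomp Require Import boolp functions.

Set Implicit Arguments.
Unset Strict Implicit.
Unset Printing Implicit Defensive.

Import GRing.Theory Num.Theory.
Import Quotient.

Local Open Scope ring_scope.
Local Open Scope quotient_scope.

(* Left R-modules are [lmodType R]; right R-modules are [lmodType R^c], so that,
   for N : lmodType R^c, the element n.r is written r *: n. *)

Definition int_rat : {pred rat} := fun q => q \is a Num.int.

Lemma int_rat_zmod_closed : zmod_closed int_rat.
Proof. by split=> [|x y]; [exact: rpred0 | exact: rpredB]. Qed.

HB.instance Definition _ := GRing.isZmodClosed.Build rat int_rat
  int_rat_zmod_closed.

Definition QZ : zmodType := {quot (int_rat : zmodClosed rat)}.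

Section CharacterModule.
Variables (R : pzRingType) (N : lmodType R^c).

Definition is_char : {pred N -> QZ} :=
  [pred chi : N -> QZ | `[< zmod_morphism chi >]].

Lemma is_char_zmod_closed : zmod_closed is_char.
Proof.
split=> [|f g].
  by rewrite inE; apply/asboolP => x y /=; rewrite subr0.
rewrite !inE => /asboolP fA /asboolP gA; apply/asboolP => x y.
have E z : (f - g) z = f z - g z by [].
by rewrite !E fA gA !opprD addrACA.
Qed.

HB.instance Definition _ := GRing.isZmodClosed.Build _ is_char
  is_char_zmod_closed.

(* N^+ = Hom_Z(N, Q/Z) *)
Record character_module := CharacterModule {
  char_fun :> N -> QZ;
  char_funP : char_fun \in is_char }.

HB.instance Definition _ := [isSub for char_fun].
HB.instance Definition _ := [Choice of character_module by <:].
HB.instance Definition _ :=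
  [SubChoice_isSubZmodule of character_module by <:].

Lemma char_zmod_morphism (chi : character_module) : zmod_morphism chi.
Proof. by have /asboolP := char_funP chi. Qed.

HB.instance Definition _ (chi : character_module) :=
  GRing.isZmodMorphism.Build N QZ chi (char_zmod_morphism chi).

Lemma char_scale_subproof (r : R) (chi : character_module) :
  (fun n : N => chi ((r : R^c) *: n)) \in is_char.
Proof. by rewrite inE; apply/asboolP => x y; rewrite scalerBr raddfB. Qed.

(* (r chi)(n) = chi(n r) *)
Definition char_scale r chi := CharacterModule (char_scale_subproof r chi).

Lemma char_scaleA a b chi :
  char_scale a (char_scale b chi) = char_scale (a * b) chi.
Proof. by apply/val_inj/funext => n /=; rewrite scalerA. Qed.

Lemma char_scale1 : left_id 1 char_scale.
Proof. by move=> chi; apply/val_inj/funext => n /=; rewrite scale1r. Qed.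

Lemma char_scaleDr : right_distributive char_scale +%R.
Proof. by move=> a f g; apply/val_inj/funext. Qed.

Lemma char_scaleDl chi :
  {morph char_scale^~ chi : a b / a + b >-> a + b}.
Proof.
by move=> a b; apply/val_inj/funext => n /=; rewrite scalerDl raddfD.
Qed.

HB.instance Definition _ := GRing.Zmodule_isLmodule.Build R character_module
  char_scaleA char_scale1 char_scaleDr char_scaleDl.

End CharacterModule.

Section Tensor.
Variables (R : pzRingType) (N : lmodType R^c) (A : lmodType R).

Inductive tens_rel : {freeg (N * A)} -> Prop :=
| TensDl n n' a : tens_rel (<<(n + n', a)>> - <<(n, a)>> - <<(n', a)>>)
| TensDr n a a' : tens_rel (<<(n, a + a')>> - <<(n, a)>> - <<(n, a')>>)
| TensZ (r : R) n a :
    tens_rel (<<((r : R^c) *: n, a)>> - <<(n, r *: a)>>).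

Definition tens_ker : {pred {freeg (N * A)}} :=
  [pred x | `[< forall S : zmodClosed {freeg (N * A)},
                  (forall y, tens_rel y -> y \in S) -> x \in S >]].

Lemma tens_ker_zmod_closed : zmod_closed tens_ker.
Proof.
split=> [|x y]; rewrite !inE.
  by apply/asboolP => S _; rewrite rpred0.
move=> /asboolP xS /asboolP yS; apply/asboolP => S relS.
by rewrite rpredB ?xS ?yS.
Qed.

HB.instance Definition _ := GRing.isZmodClosed.Build _ tens_ker
  tens_ker_zmod_closed.

Definition tensor : zmodType := {quot (tens_ker : zmodClosed _)}.

Definition tens (n : N) (a : A) : tensor := \pi_tensor <<(n, a)>>.

Lemma tens_eqP (x y : {freeg (N * A)}) :
  \pi_tensor x = \pi_tensor y <-> x - y \in tens_ker.
Proof. by rewrite idealrBE; split=> /eqP. Qed.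

Definition balanced (G : zmodType) (b : N -> A -> G) :=
  [/\ forall n n' a, b (n + n') a = b n a + b n' a,
      forall n a a', b n (a + a') = b n a + b n a' &
      forall (r : R) n a, b ((r : R^c) *: n) a = b n (r *: a)].

Lemma tens_balanced : balanced tens.
Proof.
have K x : tens_rel x -> x \in tens_ker by move=> ?; apply/asboolP => S; exact.
split=> [n n' a|n a a'|r n a]; rewrite /tens -?raddfD; apply/tens_eqP.
- by rewrite opprD addrA; apply/K/TensDl.
- by rewrite opprD addrA; apply/K/TensDr.
- exact/K/TensZ.
Qed.

(* The additive map n \otimes a |-> b n a; meaningful for balanced b only. *)
Definition tens_lift (G : zmodType) (b : N -> A -> G) (t : tensor) : G :=
  fglift (fun p => b p.1 p.2 : zmodule G) (repr t).

Section Lift.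
Variables (G : zmodType) (b : N -> A -> G).
Hypothesis bP : balanced b.

Let L : {freeg (N * A)} -> zmodule G := fglift (fun p => b p.1 p.2 : zmodule G).

Let LB : zmod_morphism L := lift_is_additive _.

HB.instance Definition _ := GRing.isZmodMorphism.Build _ _ L LB.

Let Lker : {pred {freeg (N * A)}} := fun x => L x == 0.

Let Lker_closed : zmod_closed Lker.
Proof.
split=> [|x y]; rewrite !unfold_in /Lker; first by rewrite raddf0.
by move=> /eqP Lx /eqP Ly; rewrite LB Lx Ly subr0.
Qed.

HB.instance Definition _ := GRing.isZmodClosed.Build _ Lker Lker_closed.

Let L_pi x : tens_lift b (\pi_tensor x) = L x.
Proof.
apply/eqP; rewrite -subr_eq0 -[_ - _]/(L (repr (\pi_tensor x)) - L x) -raddfB.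
have /tens_eqP/asboolP : repr (\pi_tensor x) = x %[mod tensor] by rewrite reprK.
apply: (_ : _ -> _ \in Lker); apply => y.
have [bDl bDr bZ] := bP.
have LU p : L <<p>> = b p.1 p.2 by rewrite /L liftU scale1r.
case=> [n n' a|n a a'|r n a]; rewrite unfold_in /Lker !raddfB /= !LU /=.
- by rewrite bDl addrAC addrK subrr.
- by rewrite bDr addrAC addrK subrr.
- by rewrite bZ subrr.
Qed.

Lemma tens_liftE n a : tens_lift b (tens n a) = b n a.
Proof. by rewrite /tens L_pi /L liftU scale1r. Qed.

Lemma tens_lift_zmod_morphism : zmod_morphism (tens_lift b).
Proof.
move=> x y; rewrite -[x]reprK -[y]reprK -raddfB !L_pi; exact: LB.
Qed.

End Lift.
End Tensor.

Definition tensor_map (R : pzRingType) (N N' : lmodType R^c) (A A' : lmodType R)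
    (j : {linear N -> N'}) (i : {linear A -> A'}) : tensor N A -> tensor N' A' :=
  tens_lift (fun n a => tens (j n) (i a)).

Lemma tensor_map_balanced (R : pzRingType) (N N' : lmodType R^c)
    (A A' : lmodType R) (j : {linear N -> N'}) (i : {linear A -> A'}) :
  balanced (fun n a => tens (j n) (i a)).
Proof.
have [tDl tDr tZ] := tens_balanced N' A'.
by split=> [n n' a|n a a'|r n a]; rewrite ?raddfD /= ?linearZ /= ?tDl ?tDr ?tZ.
Qed.

Lemma tensor_map_tens (R : pzRingType) (N N' : lmodType R^c)
    (A A' : lmodType R) (j : {linear N -> N'}) (i : {linear A -> A'}) n a :
  tensor_map j i (tens n a) = tens (j n) (i a).
Proof. exact/(tens_liftE (tensor_map_balanced j i)). Qed.

Lemma tensor_map_zmod_morphism (R : pzRingType) (N N' : lmodType R^c)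
    (A A' : lmodType R) (j : {linear N -> N'}) (i : {linear A -> A'}) :
  zmod_morphism (tensor_map j i).
Proof. exact/(tens_lift_zmod_morphism (tensor_map_balanced j i)). Qed.

HB.instance Definition _ (R : pzRingType) (N N' : lmodType R^c)
    (A A' : lmodType R) (j : {linear N -> N'}) (i : {linear A -> A'}) :=
  GRing.isZmodMorphism.Build _ _ (tensor_map j i)
    (tensor_map_zmod_morphism j i).

Definition pure_mono (R : pzRingType) (A B : lmodType R)
    (i : {linear A -> B}) : Prop :=
  injective i /\
  forall N : lmodType R^c,
    injective (tensor_map (idfun : {linear N -> N}) i).

Definition rpure_mono (R : pzRingType) (A B : lmodType R^c)
    (i : {linear A -> B}) : Prop :=
  injective i /\
  forall L : lmodType R,
    injective (tensor_map i (idfun : {linear L -> L})).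

Definition rpure_exact (R : pzRingType) (A B C : lmodType R^c)
    (i : {linear A -> B}) (q : {linear B -> C}) : Prop :=
  [/\ rpure_mono i,
      forall b, q b = 0 <-> exists a, i a = b &
      forall c, exists b, q b = c].

Definition pure_injective (R : pzRingType) (E : lmodType R) : Prop :=
  forall (A B : lmodType R) (i : {linear A -> B}), pure_mono i ->
  forall f : {linear A -> E}, exists g : {linear B -> E}, g \o i =1 f.

Definition rpure_projective (R : pzRingType) (P : lmodType R^c) : Prop :=
  forall (A B C : lmodType R^c) (i : {linear A -> B}) (q : {linear B -> C}),
  rpure_exact i q ->
  forall f : {linear P -> C}, exists g : {linear P -> B}, q \o g =1 f.

Section Classes.
Variable R : pzRingType.
Implicit Type X : lmodType R -> Prop.

Definition precover X (G N : lmodType R) (g : {linear G -> N}) : Prop :=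
  X G /\
  forall (G' : lmodType R) (f : {linear G' -> N}), X G' ->
  exists h : {linear G' -> G}, g \o h =1 f.

Definition preenvelope X (M E : lmodType R) (u : {linear M -> E}) : Prop :=
  X E /\
  forall (E' : lmodType R) (f : {linear M -> E'}), X E' ->
  exists h : {linear E -> E'}, h \o u =1 f.

Definition precovering X : Prop :=
  forall N : lmodType R, exists (G : lmodType R) (g : {linear G -> N}),
    precover X g.

Definition iso_closed X : Prop :=
  forall (A B : lmodType R) (f : {linear A -> B}), bijective f -> X A -> X B.

(* For a precovering class the empty direct sum is covered too: 0 is a direct
   summand of any member, and there is one. *)
Definition finite_sum_closed X : Prop :=
  forall A B : lmodType R, X A -> X B -> X (A * B)%type.

Definition summand_closed X : Prop :=
  forall A B : lmodType R, X (A * B)%type -> X A.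

(* N \in X^{-1}(M) *)
Definition precover_completing_domain X (M N : lmodType R) : Prop :=
  forall (f : {linear M -> N}) (G : lmodType R) (g : {linear G -> N}),
  precover X g -> exists h : {linear M -> G}, g \o h =1 f.

End Classes.

(* Main.v *)
(** The conditions are equivalent as soon as M embeds purely into P^+ for some
    pure-projective right module P, because character modules are pure-injective
    and h is a pure monomorphism whenever g h is one.

    To find P, let B = M^+ and, for every finite set s of R-linear equations
    between elements of B, take generators e_(s, b) (b in B) subject to the
    equations of s that hold in B; P is the direct sum over s of these modules.
    Finite systems of equations lift along pure epimorphisms, so P is
    pure-projective. The projection e_(s, b) |-> b from P to M^+ transposes to
    M -> P^+. For fixed s the map b |-> e_(s, b) is not linear, but any given
    instance of linearity holds once s is large enough. Since Q/Z is an
    injective cogenerator, M -> P^+ is pure when every pairing N x M -> Q/Z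
    extends to N x P^+; transposing the pairing to N -> M^+ and passing to a
    limit over s produces the extension. *)

From HB Require Import structures.
Require Import Defs.
From mathcomp Require Import all_boot all_order all_algebra.
From mathcomp Require Import freeg boolp classical_sets functions filter.

Set Implicit Arguments.
Unset Strict Implicit.
Unset Printing Implicit Defensive.

Import GRing.Theory Num.Theory.

Local Open Scope ring_scope.
Local Open Scope quotient_scope.
Local Open Scope classical_set_scope.

Definition Additive (G H : zmodType) (f : G -> H) (fP : zmod_morphism f) :
    {additive G -> H} :=
  HB.pack_for {additive G -> H} f (GRing.isZmodMorphism.Build _ _ f fP).

Definition Linear (R : pzRingType) (U V : lmodType R) (f : U -> V)
    (fP : linear f) : {linear U -> V} :=
  HB.pack_for {linear U -> V} f (GRing.isLinear.Build R U V *:%R f fP).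

(** * Divisible groups *)

Definition subgroup (G : zmodType) (A : set G) : Prop :=
  A 0 /\ forall x y, A x -> A y -> A (x - y).

Lemma subgroupMz (G : zmodType) (A : set G) (x : G) (n : int) :
  subgroup A -> A x -> A (x *~ n).
Proof.
move=> [A0 AB] Ax; pose mem_A : {pred G} := fun y => `[< A y >].
have mem_AP : zmod_closed mem_A.
  by split=> [|y z]; rewrite !unfold_in !asboolE //; apply: AB.
pose S : zmodClosed G := HB.pack mem_A (GRing.isZmodClosed.Build _ _ mem_AP).
have : x *~ n \in S by apply: rpredMz; rewrite unfold_in asboolE.
by rewrite unfold_in asboolE.
Qed.

Lemma subgroup0 (G : zmodType) : subgroup [set 0 : G].
Proof. by split=> // x y -> ->; rewrite subrr. Qed.

Lemma int_subgroup_principal (A : set int) :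
  subgroup A -> exists d : nat, forall n, A n <-> (d %| n)%Z.
Proof.
move=> AS; have [_ AB] := AS.
have AM m n : A m -> A (n * m)%Z by rewrite mulrC -mulrzz; apply: subgroupMz.
have [ex_pos|no_pos] := pselect (exists d : nat, (0 < d)%N && `[< A d%:Z >]).
  have [d /andP[d_gt0 /asboolP Ad] d_min] := ex_minnP ex_pos.
  exists d => n; split=> [An|/dvdzP[q ->]]; last exact: AM.
  apply/dvdz_mod0P.
  have : A (n %% d)%Z by apply: AB => //; apply: AM.
  have d_neq0 : d%:Z != 0 by rewrite -lt0n.
  have := modz_ge0 n d_neq0; have := ltz_pmod n (d_gt0 : 0 < d%:Z).
  case: (modz n d) => // -[|m] // lt_md _ Am.
  have := d_min m.+1; rewrite /= (asboolT Am) => /(_ isT).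
  by rewrite leqNgt -ltz_nat lt_md.
exists 0%N => n; split=> [An|/dvdzP[q ->]]; last by rewrite mulr0; case: AS.
rewrite dvd0z; apply: contra_notT no_pos => n_neq0.
exists `|n|%N; rewrite absz_gt0 n_neq0; apply/asboolP.
by rewrite abszEsg; apply: AM.
Qed.

Lemma subrACA (G : zmodType) (x y z t : G) :
  (x - y) - (z - t) = (x - z) - (y - t).
Proof. by rewrite !opprB addrACA [- y - z]addrC -addrACA. Qed.

Definition divisible (D : zmodType) : Prop :=
  forall (y : D) (d : nat), (0 < d)%N -> exists z, z *+ d = y.

Section DivisibleExtension.
Variables G D : zmodType.
Implicit Type A : set (G * D).

(* The graph of a homomorphism to D from a subgroup of G. *)
Definition additive_graph A : Prop :=
  subgroup A /\ forall y, A (0, y) -> y = 0.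

Lemma pairMz (x : G) (y : D) (n : int) : (x, y) *~ n = (x *~ n, y *~ n).
Proof. by rewrite [LHS]surjective_pairing (raddfMz fst) (raddfMz snd). Qed.

Lemma additive_graph_fun A x y z :
  additive_graph A -> A (x, y) -> A (x, z) -> y = z.
Proof.
move=> [[_ AB] A0] Ay Az; apply/subr0_eq/A0; rewrite -(subrr x).
exact: (AB (_, _) (_, _)).
Qed.

Lemma additive_graph_maximal A : additive_graph A ->
  exists B, [/\ additive_graph B, A `<=` B
    & forall C, additive_graph C -> B `<=` C -> C `<=` B].
Proof.
move=> AG; have [[A00 AB] A0] := AG.
pose P (B : set (G * D)) := [/\ forall u v, B u -> B v -> B (u - v),
  forall y, B (0, y) -> y = 0 & B !=set0 -> A `<=` B].
(* The third clause is conditional because Zorn's lemma also asks for a bound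
   of the empty chain. *)
have [F FP Ftot|B [[BB B0 BA] Bmax]] := @Zorn_bigcup _ P.
  split=> [u v [C FC Cu] [C' FC' C'v]|y [C FC Cy]|[u [C FC Cu]]].
  - have [CC'|C'C] := Ftot _ _ FC FC'.
      exists C' => //; have [C'B _ _] := FP _ FC'.
      by apply: C'B => //; apply: CC'.
    exists C => //; have [CB _ _] := FP _ FC.
    by apply: CB => //; apply: C'C.
  - by have [_ C0 _] := FP _ FC; apply: C0.
  - move=> v Av; exists C => //.
    by have [_ _ CA] := FP _ FC; apply: CA Av; exists u.
have B_neq0 : B !=set0.
  apply: contrapT => Bset0; apply: (Bmax A); last first.
    by split=> // _; apply: subset_refl.
  by split=> [u Bu|AsubB]; case: Bset0; [exists u|exists 0; apply: AsubB].
exists B; split=> [||C [[C00 CB] C0] BC]; last 1 first.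
- apply: contrapT => nCB; apply: (Bmax C); first by split.
  by split=> // _; apply: subset_trans BC; apply: BA.
- by split=> //; split=> //; apply: BA.
- exact: BA.
Qed.

Lemma total_additive_graph A : additive_graph A ->
  (forall x, exists y, A (x, y)) ->
  exists f : {additive G -> D}, forall x y, A (x, y) -> f x = y.
Proof.
move=> AG Atotal; have [f Af] := choice Atotal.
have fB : zmod_morphism f.
  move=> x y; have [[_ AB] _] := AG.
  by apply: additive_graph_fun AG (Af _) _; apply: (AB (_, _) (_, _)).
by exists (Additive fB) => x y; apply: additive_graph_fun AG (Af x).
Qed.

Hypothesis D_div : divisible D.

Lemma additive_graph_slope A (x : G) : additive_graph A ->
  exists y, forall n z, A (x *~ n, z) -> z = y *~ n.
Proof.
move=> AG; have [AS A0] := AG; have [A00 AB] := AS.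
have [|d dP] := @int_subgroup_principal [set n | exists z, A (x *~ n, z)].
  split=> [|m n [z Az] [w Aw]]; first by exists 0; rewrite mulr0z.
  by exists (z - w); rewrite mulrzBr; apply: (AB (_, _) (_, _)).
have [w Aw] := (dP d).2 (dvdzz d).
have [y yd] : exists y, y *~ d = w.
  case: d Aw {dP} => [|d] Aw; last by apply: D_div.
  by exists 0; rewrite mulr0z; apply/esym/A0; rewrite mulr0z in Aw.
exists y => n z Anz; have /dvdzP[k n_kd] : (d %| n)%Z by apply/dP; exists z.
apply: additive_graph_fun AG Anz _.
by rewrite n_kd mulrC !mulrzA yd -pairMz; apply: subgroupMz.
Qed.

Lemma additive_graph_adjoin A (x : G) : additive_graph A ->
  exists B, [/\ additive_graph B, A `<=` B & exists y, B (x, y)].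
Proof.
move=> AG; have [[A00 AB] A0] := AG; have [y yP] := additive_graph_slope x AG.
exists [set u | exists n, A (u - (x, y) *~ n)]; split.
- split=> [|z [n]].
    split=> [|u v [m Au] [n Av]]; first by exists 0; rewrite mulr0z subr0.
    by exists (m - n); rewrite mulrzBr subrACA; apply: AB.
  rewrite pairMz => Az; have /yP : A (x *~ (- n), z - y *~ n).
    by rewrite mulrNz -[- _]add0r.
  by rewrite mulrNz => /eqP; rewrite subr_eq addNr => /eqP.
- by move=> u Au; exists 0; rewrite mulr0z subr0.
- by exists y, 1; rewrite mulr1z subrr.
Qed.

Lemma divisible_extension A : additive_graph A ->
  exists f : {additive G -> D}, forall x y, A (x, y) -> f x = y.
Proof.
move=> /additive_graph_maximal[B [BG AsubB Bmax]].
have [x|f fP] := total_additive_graph BG.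
  have [C [CG BC [y Cxy]]] := additive_graph_adjoin x BG.
  by exists y; apply: (Bmax C).
by exists f => x y /AsubB; apply: fP.
Qed.

End DivisibleExtension.

Lemma divisible_injective (D G H : zmodType) (j : {additive G -> H})
    (f : {additive G -> D}) :
  divisible D -> injective j -> exists g : {additive H -> D}, g \o j =1 f.
Proof.
move=> D_div j_inj.
have [|g gP] := @divisible_extension H D D_div [set (j x, f x) | x in setT].
  split=> [|y [x _ [/eqP]]].
    split=> [|_ _ [x _ <-] [y _ <-]]; first by exists 0; rewrite ?raddf0.
    by exists (x - y); rewrite // !raddfB.
  by rewrite raddf_eq0 // => /eqP-> <-; rewrite raddf0.
by exists g => x; apply: gP; exists x.
Qed.

Lemma divisible_limit (D : zmodType) (I : Type) (F : set_system I) :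
  divisible D -> ProperFilter F ->
  exists lim : {additive (I -> D) -> D},
    forall u c, (\forall i \near F, u i = c) -> lim u = c.
Proof.
move=> D_div FF.
have [|lim limP] := @divisible_extension (I -> D) D D_div
    [set uc | \forall i \near F, uc.1 i = uc.2].
  split=> [|c Fc].
    split=> [|[u c] [v d]]; first exact: nearW.
    by apply: filterS2 => i /= <- <-.
  by have [i /esym] := filter_ex Fc.
by exists lim.
Qed.

Lemma pi_QZ_eq0 (q : rat) : (\pi_QZ q == 0) = (q \is a Num.int).
Proof. by rewrite -(raddf0 \pi_QZ) -Quotient.idealrBE subr0. Qed.

Lemma QZ_divisible : divisible QZ.
Proof.
move=> y d d_gt0; exists (\pi_QZ (repr y / d%:R)).
rewrite -[RHS]reprK -raddfMn; congr (\pi_QZ _).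
by rewrite -[LHS]mulr_natr mulfVK // pnatr_eq0 -lt0n.
Qed.

Lemma QZ_torsion (d : nat) : d != 1%N -> exists2 y : QZ, y != 0 & y *+ d = 0.
Proof.
move=> d_neq1.
(* The witness has order d, or 2 when d = 0. *)
exists (\pi_QZ (d.-2.+2%:R)^-1).
  rewrite pi_QZ_eq0; apply/negP => /intrP[z] z_inv.
  have : 0 < (z%:~R : rat) < 1.
    by rewrite -z_inv invr_gt0 ltr0n invf_lt1 ?ltr1n ?ltr0n.
  by rewrite ltr0z -[1]/(1%:~R) ltr_int; case: z z_inv => // -[].
case: d d_neq1 => [//|[//|d]] _ /=.
rewrite -raddfMn; apply/eqP; rewrite pi_QZ_eq0.
by rewrite -[_^-1 *+ _]mulr_natr mulVf ?rpred1 // pnatr_eq0.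
Qed.

Lemma character_separation (G : zmodType) (A : set G) (x : G) :
  subgroup A -> ~ A x ->
  exists2 chi : {additive G -> QZ}, forall y, A y -> chi y = 0 & chi x != 0.
Proof.
move=> AS nAx; have [A0 AB] := AS.
have [|d dP] := @int_subgroup_principal [set n | A (x *~ n)].
  by split=> [|m n Am An]; rewrite /= ?mulr0z // mulrzBr; apply: AB.
have [|y y_neq0 yd] := @QZ_torsion d.
  by apply: contra_notN nAx => /eqP d1; apply/(dP 1); rewrite d1.
have [|chi chiP] := @divisible_extension G QZ QZ_divisible
  [set u | exists2 n, A (u.1 - x *~ n) & u.2 = y *~ n].
  split=> [|z [n /=]].
    split=> [|u v [m Au u2] [n Av v2]].
      by exists 0; rewrite ?mulr0z ?subr0.
    exists (m - n); last by rewrite /= u2 v2 mulrzBr.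
    by rewrite /= mulrzBr subrACA; apply: AB.
  rewrite sub0r -mulrNz => /dP; rewrite rpredN => /dvdzP[k -> ->].
  by rewrite mulrC mulrzA -pmulrn yd mul0rz.
exists chi => [z Az|]; first by apply: chiP; exists 0; rewrite ?mulr0z ?subr0.
by rewrite (chiP x y) //; exists 1; rewrite ?mulr1z ?subrr.
Qed.

(** * Characters and purity *)

Section BalancedMaps.
Variables (R : pzRingType) (N : lmodType R^c) (A : lmodType R).

Lemma tens_ext (G : zmodType) (f g : {additive tensor N A -> G}) :
  (forall n a, f (tens n a) = g (tens n a)) -> f =1 g.
Proof.
move=> fg t; rewrite -[t]reprK -[repr t]freeg_sumE !raddf_sum /=.
apply: eq_bigr => -[n a] _.
have := freegU_mulz int (coeff (n, a) (repr t)) (n, a).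
by rewrite intz => <-; rewrite !raddfMz; congr (_ *~ _); apply: fg.
Qed.

Variables (G : zmodType) (b : N -> A -> G).
Hypothesis b_bal : balanced b.

Lemma balancedBl (a : A) : zmod_morphism (b^~ a).
Proof.
have [bDl _ _] := b_bal; move=> n n'.
by apply/eqP; rewrite eq_sym subr_eq -bDl subrK.
Qed.

Lemma balancedBr (n : N) : zmod_morphism (b n).
Proof.
have [_ bDr _] := b_bal; move=> a a'.
by apply/eqP; rewrite eq_sym subr_eq -bDr subrK.
Qed.

Lemma balanced_additive (H : zmodType) (f : {additive G -> H}) :
  balanced (fun n a => f (b n a)).
Proof.
have [bDl bDr bZ] := b_bal.
by split=> [n n' a|n a a'|r n a]; rewrite ?bDl ?bDr ?bZ ?raddfD.
Qed.

Lemma balanced_linear (N' : lmodType R^c) (A' : lmodType R)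
    (j : {linear N' -> N}) (i : {linear A' -> A}) :
  balanced (fun n a => b (j n) (i a)).
Proof.
have [bDl bDr bZ] := b_bal.
by split=> [n n' a|n a a'|r n a];
  rewrite ?raddfD ?bDl ?bDr ?linearZ /= ?linearZ ?bZ.
Qed.

End BalancedMaps.

Section CharacterModules.
Variables (R : pzRingType) (N : lmodType R^c).

Lemma additive_is_char (chi : {additive N -> QZ}) :
  (chi : N -> QZ) \in @is_char R N.
Proof. by rewrite inE => x y; rewrite raddfB. Qed.

Definition char_of_additive (chi : {additive N -> QZ}) : character_module N :=
  CharacterModule (additive_is_char chi).

Lemma char_ext (chi psi : character_module N) : chi =1 psi -> chi = psi.
Proof. by move=> chi_psi; apply/val_inj/funext. Qed.

Lemma charD (chi psi : character_module N) (n : N) :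
  (chi + psi) n = chi n + psi n.
Proof. by []. Qed.

Lemma charZ (r : R) (chi : character_module N) (n : N) :
  (r *: chi) n = chi ((r : R^c) *: n).
Proof. by []. Qed.

Lemma char_sum (I : Type) (s : seq I) (chi : I -> character_module N) (n : N) :
  (\sum_(i <- s) chi i) n = \sum_(i <- s) chi i n.
Proof. by elim/big_rec2: _ => [|i x y _ <-]; rewrite ?charD. Qed.

Lemma char_eval_balanced (A : lmodType R)
    (f : {linear A -> character_module N}) :
  balanced (fun n a => f a n).
Proof.
by split=> [n n' a|n a a'|r n a]; rewrite ?raddfD // linearZ.
Qed.

Lemma char_curry (A : lmodType R) (b : N -> A -> QZ) : balanced b ->
  exists f : {linear A -> character_module N}, forall n a, f a n = b n a.
Proof.
move=> b_bal; have [_ bDr bZ] := b_bal.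
pose f a := char_of_additive (Additive (balancedBl b_bal a)).
have f_lin : linear f.
  by move=> r a a'; apply: char_ext => n; rewrite charD charZ /= bDr bZ.
by exists (Linear f_lin).
Qed.

End CharacterModules.

(* Balanced maps to Q/Z are the characters of the tensor product, so this holds
   because Q/Z is an injective cogenerator. *)
Lemma tensor_map_injectiveP (R : pzRingType) (N N' : lmodType R^c)
    (A A' : lmodType R) (j : {linear N -> N'}) (i : {linear A -> A'}) :
  injective (tensor_map j i) <->
  forall b : N -> A -> QZ, balanced b -> exists2 b' : N' -> A' -> QZ,
    balanced b' & forall n a, b' (j n) (i a) = b n a.
Proof.
split=> [ji_inj b b_bal|b_ext].
  have [g gE] := divisible_injective
    (Additive (tens_lift_zmod_morphism b_bal)) QZ_divisible ji_inj.
  exists (fun n' a' => g (tens n' a')) => [|n a].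
    exact/balanced_additive/tens_balanced.
  by rewrite -tensor_map_tens [LHS]gE; apply: tens_liftE.
apply: raddf_inj => t ji_t; apply: contrapT => t_neq0.
have [chi _ /eqP[]] := character_separation (subgroup0 _) t_neq0.
have [b' b'_bal b'E] := b_ext _ (balanced_additive (tens_balanced N A) chi).
pose chi' := Additive (tens_lift_zmod_morphism b'_bal).
rewrite -(raddf0 chi') -ji_t.
apply: (@tens_ext _ _ _ _ _ (chi' \o tensor_map j i)) => n a.
by rewrite [RHS]/= tensor_map_tens [RHS](tens_liftE b'_bal) b'E.
Qed.

Section Purity.
Variable R : pzRingType.

Lemma pure_monoP (A B : lmodType R) (i : {linear A -> B}) :
  pure_mono i <->
  forall (N : lmodType R^c) (b : N -> A -> QZ), balanced b ->
    exists2 b' : N -> B -> QZ,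
      balanced b' & forall n a, b' n (i a) = b n a.
Proof.
split=> [[_ i_pure] N|b_ext].
  exact: (tensor_map_injectiveP (idfun : {linear N -> N}) i).1 (i_pure N).
split=> [|N]; last exact/tensor_map_injectiveP/b_ext.
apply: raddf_inj => a ia0; apply: contrapT => a_neq0.
have [chi _ /eqP[]] := character_separation (subgroup0 _) a_neq0.
have b_bal : balanced (fun (r : (R^c)^o) a' => chi ((r : R) *: a')).
  split=> [r r' a'|r a' a''|r r' a'].
  - by rewrite scalerDl raddfD.
  - by rewrite scalerDr raddfD.
  - by rewrite scalerA.
have [b' b'_bal b'E] := b_ext _ _ b_bal.
have := b'E 1 a; rewrite scale1r => <-; rewrite ia0.
exact: (raddf0 (Additive (balancedBr b'_bal 1))).
Qed.

Lemma pure_mono_comp_inv (A B C : lmodType R) (h : {linear A -> B})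
    (g : {linear B -> C}) (i : {linear A -> C}) :
  g \o h =1 i -> pure_mono i -> pure_mono h.
Proof.
move=> ghi /pure_monoP i_pure; apply/pure_monoP => N b /i_pure[b' b'_bal b'E].
exists (fun n x => b' n (g x)) => [|n a].
  exact: (balanced_linear b'_bal (idfun : {linear N -> N})).
by rewrite -b'E -ghi.
Qed.

Lemma char_pure_injective (N : lmodType R^c) :
  pure_injective (character_module N).
Proof.
move=> A B i /pure_monoP i_pure f.
have [b b_bal bE] := i_pure _ _ (char_eval_balanced f).
have [g gE] := char_curry b_bal.
by exists g => a; apply: char_ext => n; rewrite /= gE bE.
Qed.

Lemma rpure_mono_dual_split (A B : lmodType R^c) (i : {linear A -> B}) :
  rpure_mono i ->
  exists sigma : {linear character_module A -> character_module B},
    forall chi a, sigma chi (i a) = chi a.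
Proof.
move=> [_ i_pure]; have [ext _] := tensor_map_injectiveP i
  (idfun : {linear character_module A -> character_module A}).
have [b b_bal bE] := ext (i_pure _) _
  (char_eval_balanced (idfun : {linear character_module A -> _})).
have [sigma sigmaE] := char_curry b_bal.
by exists sigma => chi a; rewrite sigmaE bE.
Qed.

End Purity.

(** * Finite systems of linear equations *)

Section LinearCombinations.
Variable S : pzRingType.

Definition lin_comb (X : Type) (V : lmodType S) (e : X -> V)
    (rho : seq (S * X)) : V :=
  \sum_(p <- rho) p.1 *: e p.2.

Definition solution (X : Type) (rels : set (seq (S * X))) (V : lmodType S)
    (e : X -> V) : Prop :=
  forall rho, rels rho -> lin_comb e rho = 0.

Lemma lin_comb_linear (X : Type) (U V : lmodType S) (f : {linear U -> V})
    (e : X -> U) rho :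
  lin_comb (f \o e) rho = f (lin_comb e rho).
Proof.
by rewrite /lin_comb linear_sum; apply: eq_bigr => p _; rewrite linearZ.
Qed.

Lemma lin_combB (X : Type) (V : lmodType S) (e e' : X -> V) rho :
  lin_comb (e \- e') rho = lin_comb e rho - lin_comb e' rho.
Proof.
by rewrite /lin_comb -sumrB; apply: eq_bigr => p _; rewrite scalerBr.
Qed.

Lemma lin_comb_cat (X : Type) (V : lmodType S) (e : X -> V) rho sigma :
  lin_comb e (rho ++ sigma) = lin_comb e rho + lin_comb e sigma.
Proof. exact: big_cat. Qed.

Definition scale_comb (X : Type) (a : S) (rho : seq (S * X)) :
    seq (S * X) :=
  [seq (a * p.1, p.2) | p <- rho].

Lemma lin_comb_scale (X : Type) (V : lmodType S) (e : X -> V) a rho :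
  lin_comb e (scale_comb a rho) = a *: lin_comb e rho.
Proof.
rewrite /lin_comb big_map scaler_sumr.
by apply: eq_bigr => p _; rewrite scalerA.
Qed.

Lemma lin_comb_seq1 (X : Type) (V : lmodType S) (e : X -> V) x :
  lin_comb e [:: (1, x)] = e x.
Proof. by rewrite /lin_comb big_seq1 scale1r. Qed.

Definition total_coef (X : eqType) (x : X) (rho : seq (S * X)) : S :=
  \sum_(p <- rho | p.2 == x) p.1.

Lemma lin_comb_collect (X : eqType) (V : lmodType S) (e : X -> V)
    (W : seq X) rho :
  uniq W -> {subset [seq p.2 | p <- rho] <= W} ->
  lin_comb e rho = \sum_(x <- W) total_coef x rho *: e x.
Proof.
move=> W_uniq rhoW; under [RHS]eq_bigr => x _.
  rewrite /total_coef scaler_suml big_mkcond /=; over.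
rewrite exchange_big /=; apply: eq_big_seq => p rho_p.
have Wp : p.2 \in W by apply/rhoW/map_f.
rewrite (bigD1_seq p.2) //= eqxx big1_seq ?addr0 // => x /andP[xp _].
by rewrite eq_sym (negbTE xp).
Qed.

End LinearCombinations.

Section EquationalPurity.
Variable R : pzRingType.

Lemma char_family_separation (N : lmodType R^c) (I : finType)
    (A : set (I -> N)) (u : I -> N) :
  subgroup A -> ~ A u ->
  exists2 chi : I -> character_module N,
    forall v, A v -> \sum_k chi k (v k) = 0 & \sum_k chi k (u k) != 0.
Proof.
move=> AS nAu; have [chi chi0 chiu] := character_separation AS nAu.
pose delta k (x : N) : I -> N := fun k' => if k' == k then x else 0.
have deltaB k : zmod_morphism (chi \o delta k).
  move=> x y /=; rewrite -raddfB; congr (chi _); apply/funext => k'.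
  rewrite -[RHS]/(delta k x k' - delta k y k') /delta.
  by case: ifP; rewrite ?subr0.
have chiE v : chi v = \sum_k chi (delta k (v k)).
  rewrite -raddf_sum fct_sumE; congr (chi _); apply/funext => k.
  rewrite (bigD1 k) //= /delta eqxx big1 ?addr0 // => k'.
  by rewrite eq_sym => /negbTE->.
exists (fun k => char_of_additive (Additive (deltaB k))) => [v Av|].
  by have := chi0 v Av; rewrite chiE.
by move: chiu; rewrite chiE.
Qed.

Lemma char_lin_comb_collect (N : lmodType R^c) (I : finType) (X : eqType)
    (chi : I -> character_module N) (rho : I -> seq (R^c * X)) (b : X -> N)
    (W : seq X) :
  uniq W -> (forall k, {subset [seq p.2 | p <- rho k] <= W}) ->
  \sum_k chi k (lin_comb b (rho k)) =
    \sum_(x <- W) (\sum_k (total_coef x (rho k) : R) *: chi k) (b x).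
Proof.
move=> W_uniq rhoW; under [RHS]eq_bigr => x _ do rewrite char_sum.
rewrite exchange_big /=; apply: eq_bigr => k _.
rewrite (lin_comb_collect _ W_uniq (rhoW k)) raddf_sum.
by apply: eq_bigr => x _ /=; rewrite -charZ.
Qed.

Lemma char_annihilatorP (N : lmodType R^c) (I : finType) (X : eqType)
    (chi : I -> character_module N) (rho : I -> seq (R^c * X)) :
  (forall b : X -> N, \sum_k chi k (lin_comb b (rho k)) = 0) <->
  (forall x, \sum_k (total_coef x (rho k) : R) *: chi k = 0).
Proof.
pose W x := undup (x ++ flatten [seq [seq p.2 | p <- rho k] | k <- enum I]).
have W_uniq x : uniq (W x) := undup_uniq _.
have rhoW x k : {subset [seq p.2 | p <- rho k] <= W x}.
  move=> y yk; rewrite mem_undup mem_cat; apply/orP; right.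
  by apply/flatten_mapP; exists k; rewrite ?mem_enum.
split=> [chi0 x|coef0 b]; last first.
  rewrite (char_lin_comb_collect _ _ (W_uniq [::]) (rhoW [::])).
  by rewrite big1 // => x _; rewrite coef0.
apply: char_ext => y; pose delta x' : N := if x' == x then y else 0.
rewrite -[RHS](chi0 delta).
rewrite (char_lin_comb_collect _ _ (W_uniq [:: x]) (rhoW [:: x])).
rewrite (bigD1_seq x) ?mem_undup ?mem_head //=.
rewrite /delta eqxx [X in _ + X]big1 ?addr0 // => x' /negbTE->.
exact: raddf0.
Qed.

(* If [a] were not a value of the system on A, then some characters of A would
   separate it from the values; the splitting of B^+ -> A^+ carries them to
   characters of B that vanish on all values of the system on B. *)
Lemma rpure_mono_solve (A B : lmodType R^c) (i : {linear A -> B})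
    (I : finType) (X : eqType) (rho : I -> seq (R^c * X)) (a : I -> A)
    (b : X -> B) :
  rpure_mono i -> (forall k, i (a k) = lin_comb b (rho k)) ->
  exists a' : X -> A, forall k, a k = lin_comb a' (rho k).
Proof.
move=> /rpure_mono_dual_split[sigma sigmaE] ab.
pose values :=
  [set v : I -> A | exists a', forall k, v k = lin_comb a' (rho k)].
have values_sub : subgroup values.
  split=> [|v w [a1 vE] [a2 wE]].
    by exists (fun=> 0) => k; rewrite /lin_comb big1 // => p _; rewrite scaler0.
  by exists (a1 \- a2) => k; rewrite lin_combB -vE -wE.
apply: contrapT => no_sol.
have [chi chi0 /eqP[]] := char_family_separation values_sub no_sol.
have /char_annihilatorP chi_coef0 (c : X -> A) :
    \sum_k chi k (lin_comb c (rho k)) = 0 by apply: chi0; exists c.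
under eq_bigr => k _ do rewrite -sigmaE ab.
apply: (char_annihilatorP (sigma \o chi) rho).2 => x.
under eq_bigr => k _ do rewrite /= -linearZ.
by rewrite -linear_sum chi_coef0 raddf0.
Qed.

Lemma rpure_exact_lift_solution (A B C : lmodType R^c) (i : {linear A -> B})
    (q : {linear B -> C}) (X : eqType) (s : seq (seq (R^c * X))) (c : X -> C) :
  rpure_exact i q -> solution [set` s] c ->
  exists2 b : X -> B, solution [set` s] b & q \o b =1 c.
Proof.
move=> [i_pure q_ker q_surj] cs.
have [b bE] := choice (fun x => q_surj (c x)).
pose rho (k : 'I_(size s)) := nth [::] s k.
have defect k : exists a, i a = lin_comb b (rho k).
  apply/q_ker; rewrite -lin_comb_linear.
  by rewrite (_ : q \o b = c); [apply/cs/mem_nth | apply/funext].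
have [a aE] := choice defect.
have [a' a'E] := rpure_mono_solve i_pure aE.
exists (b \- (i \o a')) => [_ /(nthP [::])[k k_lt <-]|x].
  by rewrite lin_combB lin_comb_linear -(a'E (Ordinal k_lt)) aE subrr.
rewrite /= raddfB /= bE (_ : q (i _) = 0) ?subr0 //.
by apply/q_ker; exists (a' x).
Qed.

End EquationalPurity.

(** * Generators and relations *)

Section Presentation.
Variables (S : pzRingType) (X : choiceType) (rels : set (seq (S * X))).
Implicit Types (rho sigma : seq (S * X)) (V : lmodType S).

(* Formal combinations are identified when they agree at every solution of rels
   in every module; each module axiom is then checked after evaluation. *)
Definition pres_equiv rho sigma : bool :=
  `[< forall V (e : X -> V), solution rels e ->
        lin_comb e rho = lin_comb e sigma >].

Lemma pres_equiv_class : equiv_class_of pres_equiv.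
Proof.
split=> [rho|rho sigma|sigma rho tau].
- exact/asboolP.
- by apply/asboolP/asboolP => eqv V e /eqv.
- move=> /asboolP rs /asboolP st; apply/asboolP => V e eP.
  by rewrite (rs _ _ eP) (st _ _ eP).
Qed.

Canonical pres_equiv_rel := EquivRelPack pres_equiv_class.
Canonical pres_enc_mod_rel := defaultEncModRel pres_equiv.

Definition presented := {eq_quot pres_equiv}.
HB.instance Definition _ := Choice.on presented.

Definition pres_eval V (e : X -> V) (x : presented) : V := lin_comb e (repr x).

Lemma pres_eval_pi V (e : X -> V) rho :
  solution rels e -> pres_eval e (\pi_presented rho) = lin_comb e rho.
Proof.
have /eqmodP/asboolP : repr (\pi_presented rho) = rho %[mod presented].
  by rewrite reprK.
exact.
Qed.

Lemma pres_eval_inj (x y : presented) :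
  (forall V (e : X -> V), solution rels e -> pres_eval e x = pres_eval e y) ->
  x = y.
Proof.
by move=> xy; rewrite -[x]reprK -[y]reprK; apply/eqmodP/asboolP.
Qed.

Definition pres_zero : presented := \pi_presented [::].
Definition pres_add (x y : presented) : presented :=
  \pi_presented (repr x ++ repr y).
Definition pres_scale (a : S) (x : presented) : presented :=
  \pi_presented (scale_comb a (repr x)).
Definition pres_opp (x : presented) : presented := pres_scale (-1) x.

Lemma pres_eval0 V (e : X -> V) :
  solution rels e -> pres_eval e pres_zero = 0.
Proof. by move=> eP; rewrite pres_eval_pi // /lin_comb big_nil. Qed.

Lemma pres_evalD V (e : X -> V) x y : solution rels e ->
  pres_eval e (pres_add x y) = pres_eval e x + pres_eval e y.
Proof. by move=> eP; rewrite pres_eval_pi // lin_comb_cat. Qed.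

Lemma pres_evalZ V (e : X -> V) a x : solution rels e ->
  pres_eval e (pres_scale a x) = a *: pres_eval e x.
Proof. by move=> eP; rewrite pres_eval_pi // lin_comb_scale. Qed.

Lemma pres_addA : associative pres_add.
Proof.
by move=> x y z; apply: pres_eval_inj => V e eP; rewrite !pres_evalD // addrA.
Qed.

Lemma pres_addC : commutative pres_add.
Proof.
by move=> x y; apply: pres_eval_inj => V e eP; rewrite !pres_evalD // addrC.
Qed.

Lemma pres_add0 : left_id pres_zero pres_add.
Proof.
move=> x; apply: pres_eval_inj => V e eP.
by rewrite pres_evalD // pres_eval0 // add0r.
Qed.

Lemma pres_addN : left_inverse pres_zero pres_opp pres_add.
Proof.
move=> x; apply: pres_eval_inj => V e eP.
by rewrite pres_evalD // pres_evalZ // pres_eval0 // scaleN1r addNr.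
Qed.

HB.instance Definition _ := GRing.isZmodule.Build presented
  pres_addA pres_addC pres_add0 pres_addN.

Lemma pres_scaleA a b x :
  pres_scale a (pres_scale b x) = pres_scale (a * b) x.
Proof.
by apply: pres_eval_inj => V e eP; rewrite !pres_evalZ // scalerA.
Qed.

Lemma pres_scale1 : left_id 1 pres_scale.
Proof.
by move=> x; apply: pres_eval_inj => V e eP; rewrite pres_evalZ // scale1r.
Qed.

Lemma pres_scaleDr : right_distributive pres_scale +%R.
Proof.
move=> a x y; apply: pres_eval_inj => V e eP.
by rewrite pres_evalZ // !pres_evalD // !pres_evalZ // scalerDr.
Qed.

Lemma pres_scaleDl x : {morph pres_scale^~ x : a b / a + b >-> a + b}.
Proof.
move=> a b; apply: pres_eval_inj => V e eP.
by rewrite pres_evalD // !pres_evalZ // scalerDl.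
Qed.

HB.instance Definition _ := GRing.Zmodule_isLmodule.Build S presented
  pres_scaleA pres_scale1 pres_scaleDr pres_scaleDl.

Definition pres_gen (x : X) : presented := \pi_presented [:: (1, x)].

Lemma pres_eval_linear V (e : X -> V) :
  solution rels e -> linear (pres_eval e).
Proof. by move=> eP a x y; rewrite pres_evalD // pres_evalZ. Qed.

Lemma pres_eval_gen V (e : X -> V) x :
  solution rels e -> pres_eval e (pres_gen x) = e x.
Proof. by move=> eP; rewrite pres_eval_pi // lin_comb_seq1. Qed.

Lemma pres_universal V (e : X -> V) : solution rels e ->
  exists f : {linear presented -> V}, f \o pres_gen =1 e.
Proof.
move=> eP; exists (Linear (pres_eval_linear eP)) => x; exact: pres_eval_gen.
Qed.

Lemma lin_comb_pres_gen rho : lin_comb pres_gen rho = \pi_presented rho.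
Proof.
apply: pres_eval_inj => V e eP; rewrite pres_eval_pi //.
rewrite -[LHS]/(Linear (pres_eval_linear eP) _) -lin_comb_linear.
by congr lin_comb; apply/funext => x; apply: pres_eval_gen.
Qed.

Lemma pres_gen_solution : solution rels pres_gen.
Proof.
move=> rho rels_rho; rewrite lin_comb_pres_gen.
apply: pres_eval_inj => V e eP.
by rewrite pres_eval_pi // (eP _ rels_rho) pres_eval0.
Qed.

Lemma pres_ext V (f g : {linear presented -> V}) :
  f \o pres_gen =1 g \o pres_gen -> f =1 g.
Proof.
move=> /funext fg x.
by rewrite -[x]reprK -lin_comb_pres_gen -!lin_comb_linear fg.
Qed.

End Presentation.

Section SumOfFinitelyRelated.
Variables (S : pzRingType) (I X : choiceType).
Variable s : I -> seq (seq (S * X)).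

(* The direct sum over i of the modules with generators X and the finitely many
   relations s i. *)
Definition block_rels : set (seq (S * (I * X))) :=
  [set rho | exists i, exists2 sigma, sigma \in s i
     & rho = [seq (p.1, (i, p.2)) | p <- sigma]].

Definition finrel_sum : lmodType S := presented block_rels.

Definition finrel_gen (i : I) (x : X) : finrel_sum :=
  pres_gen block_rels (i, x).

Lemma block_rels_solutionP (V : lmodType S) (e : I -> X -> V) :
  solution block_rels (uncurry e) <-> forall i, solution [set` s i] (e i).
Proof.
have lin_comb_block i sigma :
    lin_comb (uncurry e) [seq (p.1, (i, p.2)) | p <- sigma] =
    lin_comb (e i) sigma by rewrite /lin_comb big_map.
split=> [eP i sigma s_sigma|eP _ [i [sigma s_sigma ->]]].
  by rewrite -lin_comb_block; apply: eP; exists i, sigma.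
by rewrite lin_comb_block; apply: eP.
Qed.

Lemma finrel_gen_solution i : solution [set` s i] (finrel_gen i).
Proof.
apply: (block_rels_solutionP finrel_gen).1.
by rewrite (_ : uncurry _ = pres_gen block_rels);
  [exact: pres_gen_solution | apply/funext => -[]].
Qed.

Lemma finrel_universal (V : lmodType S) (e : I -> X -> V) :
  (forall i, solution [set` s i] (e i)) ->
  exists f : {linear finrel_sum -> V}, forall i x, f (finrel_gen i x) = e i x.
Proof.
move=> /block_rels_solutionP/pres_universal[f fE].
by exists f => i x; apply: (fE (i, x)).
Qed.

Lemma finrel_ext (V : lmodType S) (f g : {linear finrel_sum -> V}) :
  (forall i x, f (finrel_gen i x) = g (finrel_gen i x)) -> f =1 g.
Proof. by move=> fg; apply: pres_ext => -[i x]; apply: fg. Qed.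

End SumOfFinitelyRelated.

Lemma finrel_sum_pure_projective (R : pzRingType) (I X : choiceType)
    (s : I -> seq (seq (R^c * X))) :
  rpure_projective (finrel_sum s).
Proof.
move=> A B C i q iq f.
have lift j : exists e : X -> B,
    solution [set` s j] e /\ q \o e =1 f \o finrel_gen s j.
  have [|e eP qe] := rpure_exact_lift_solution (s := s j)
    (c := f \o finrel_gen s j) iq; last by exists e.
  by move=> rho s_rho; rewrite lin_comb_linear finrel_gen_solution ?raddf0.
have [e eP] := choice lift.
have [g gE] := finrel_universal (fun j => (eP j).1).
exists g; apply: (finrel_ext (f := q \o g)) => j x /=.
by rewrite gE; apply: (eP j).2.
Qed.

(** * A pure embedding into the dual of a pure-projective module *)

Definition finite_subsets (T : eqType) : set_system (seq T) :=
  filter_from setT (fun t : seq T => [set s : seq T | {subset t <= s}]).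

Lemma finite_subsets_filter (T : eqType) : ProperFilter (@finite_subsets T).
Proof.
apply: filter_from_proper => [|t _]; last by exists t => x.
apply: filter_fromT_filter => [|t t']; first by exists [::].
exists (t ++ t') => s tt's.
by split=> x x_t; apply: tt's; rewrite mem_cat x_t ?orbT.
Qed.

#[local] Existing Instance finite_subsets_filter.

Lemma finite_subsets_mem (T : eqType) (x : T) :
  \forall s \near @finite_subsets T, x \in s.
Proof. by exists [:: x] => // s xs; apply: xs; apply: mem_head. Qed.

Section FiniteSystemCover.
Variables (S : pzRingType) (B : lmodType S).

Definition true_equations (s : seq (seq (S * B))) : seq (seq (S * B)) :=
  [seq rho <- s | lin_comb id rho == 0].

Definition system_cover : lmodType S := finrel_sum true_equations.

Definition system_gen : seq (seq (S * B)) -> B -> system_cover :=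
  finrel_gen true_equations.

Lemma system_cover_proj :
  exists q : {linear system_cover -> B}, forall s b, q (system_gen s b) = b.
Proof.
apply: (@finrel_universal _ _ _ true_equations B (fun _ => id)) => s rho.
by rewrite /= mem_filter => /andP[/eqP].
Qed.

Lemma system_gen_near (rho sigma : seq (S * B)) :
  lin_comb id rho = lin_comb id sigma ->
  \forall s \near @finite_subsets _,
    lin_comb (system_gen s) rho = lin_comb (system_gen s) sigma.
Proof.
move=> rho_sigma; pose difference := rho ++ scale_comb (-1) sigma.
have differenceE (V : lmodType S) (e : B -> V) :
    lin_comb e difference = lin_comb e rho - lin_comb e sigma.
  by rewrite lin_comb_cat lin_comb_scale scaleN1r.
apply: filterS (finite_subsets_mem difference) => s s_difference.
apply/subr0_eq; rewrite -differenceE; apply: finrel_gen_solution.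
by rewrite /= mem_filter differenceE rho_sigma subrr eqxx.
Qed.

Lemma system_genD_near (b b' : B) : \forall s \near @finite_subsets _,
  system_gen s (b + b') = system_gen s b + system_gen s b'.
Proof.
have := @system_gen_near [:: (1, b + b')] [:: (1, b); (1, b')].
rewrite /lin_comb unlock /= !scale1r !addr0 => /(_ erefl).
by apply: filterS => s; rewrite !scale1r !addr0.
Qed.

Lemma system_genZ_near (r : S) (b : B) : \forall s \near @finite_subsets _,
  system_gen s (r *: b) = r *: system_gen s b.
Proof.
have := @system_gen_near [:: (1, r *: b)] [:: (r, b)].
rewrite /lin_comb unlock /= scale1r !addr0 => /(_ erefl).
by apply: filterS => s; rewrite scale1r !addr0.
Qed.

End FiniteSystemCover.

Section ConverseTwice.
Variables (R : pzRingType) (M : lmodType R).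

(* R^c^c is not convertible to R for abstract R. *)
Definition converse2 : Type := M.

HB.instance Definition _ := GRing.Zmodule.on converse2.

Definition converse2_scale (r : R^c^c) (m : converse2) : converse2 :=
  ((r : R) *: (m : M) : M).

Lemma converse2_scaleA a b m :
  converse2_scale a (converse2_scale b m) = converse2_scale (a * b) m.
Proof. exact: scalerA. Qed.

Lemma converse2_scale1 : left_id 1 converse2_scale.
Proof. exact: scale1r. Qed.

Lemma converse2_scaleDr : right_distributive converse2_scale +%R.
Proof. by move=> a m m'; apply: (@scalerDr R M). Qed.

Lemma converse2_scaleDl m :
  {morph converse2_scale^~ m : a b / a + b >-> a + b}.
Proof. by move=> a b; apply: (@scalerDl R M). Qed.

HB.instance Definition _ := GRing.Zmodule_isLmodule.Build R^c^c converse2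
  converse2_scaleA converse2_scale1 converse2_scaleDr converse2_scaleDl.

(* M^+ as a right module *)
Definition left_character_module : lmodType R^c := character_module converse2.

Lemma balanced_flip (N : lmodType R^c) (b : N -> M -> QZ) :
  balanced b <-> balanced (fun (m : converse2) n => b n m).
Proof.
by split=> -[bDl bDr bZ]; (split=> *; [exact: bDr | exact: bDl | rewrite -bZ]).
Qed.

Lemma left_char_curry (N : lmodType R^c) (b : N -> M -> QZ) : balanced b ->
  exists f : {linear N -> left_character_module}, forall n m, f n m = b n m.
Proof.
by move=> /balanced_flip/char_curry[f fE]; exists f => n m; apply: fE.
Qed.

Lemma left_char_transpose (P : lmodType R^c)
    (q : {linear P -> left_character_module}) :
  exists i : {linear M -> character_module P}, forall m p, i m p = q p m.
Proof.
have /char_curry[i iE] : balanced (fun p (m : M) => q p m).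
  exact/balanced_flip/char_eval_balanced.
by exists i => m p; apply: iE.
Qed.

End ConverseTwice.

(* Given a pairing b of N with M, let phi : N -> M^+ be its transpose. The
   generators e_(s, phi n) are linear in n once s is large enough, so that
   (n, xi) |-> lim_s xi (e_(s, phi n)) is a pairing of N with P^+. *)
Lemma system_cover_transpose_pure (R : pzRingType) (M : lmodType R)
    (q : {linear system_cover (left_character_module M) ->
            left_character_module M})
    (i : {linear M -> character_module _}) :
  (forall s b, q (system_gen s b) = b) -> (forall m p, i m p = q p m) ->
  pure_mono i.
Proof.
move=> qE iE; apply/pure_monoP => N b /left_char_curry[phi phiE].
have [lim limE] := divisible_limit QZ_divisible
  (finite_subsets_filter (seq (R^c * left_character_module M))).
have lim_near u v : (\forall s \near @finite_subsets _, u s = v s) ->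
    lim u = lim v.
  move=> uv; apply/subr0_eq; rewrite -raddfB; apply: limE.
  by apply: filterS uv => s; rewrite opprfctE addrfctE => ->; rewrite subrr.
exists (fun n (xi : character_module _) =>
  lim (fun s => xi (system_gen s (phi n)))) => [|n m].
  split=> [n n' xi|n xi xi'|r n xi]; rewrite -?raddfD; apply: lim_near.
  - apply: filterS (system_genD_near (phi n) (phi n')) => s genD.
    by rewrite raddfD genD raddfD.
  - exact: nearW.
  - apply: filterS (system_genZ_near (r : R^c) (phi n)) => s genZ.
    by rewrite linearZ genZ charZ.
by apply: limE; apply: nearW => s; rewrite iE qE phiE.
Qed.

Lemma pure_in_dual_of_pure_projective (R : pzRingType) (M : lmodType R) :
  exists (P : lmodType R^c) (i : {linear M -> character_module P}),
    rpure_projective P /\ pure_mono i.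
Proof.
have [q qE] := system_cover_proj (left_character_module M).
have [i iE] := left_char_transpose q.
exists (system_cover (left_character_module M)), i.
split; first exact: finrel_sum_pure_projective.
exact: system_cover_transpose_pure qE iE.
Qed.

Section PrecoverCompletingDomain.
Variables (R : pzRingType) (X : lmodType R -> Prop) (M : lmodType R).

Lemma pure_mono_completing (G E : lmodType R) (i : {linear M -> G}) :
  X G -> pure_mono i -> pure_injective E -> precover_completing_domain X M E.
Proof.
move=> XG i_pure E_pi f G' g [_ g_lift].
have [f' f'E] := E_pi _ _ _ i_pure f.
have [h hE] := g_lift _ f' XG.
by exists (h \o i) => m; rewrite -f'E; apply: hE.
Qed.

Lemma completing_through (E N : lmodType R) (u : {linear M -> E}) :
  precovering X ->
  (forall f : {linear M -> N}, exists h : {linear E -> N}, h \o u =1 f) ->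
  precover_completing_domain X M E -> precover_completing_domain X M N.
Proof.
move=> X_precov u_ext ME f G g [XG g_lift].
have [h hE] := u_ext f.
have [G' [g' g'_pre]] := X_precov E.
have [k kE] := ME u _ _ g'_pre.
have [l lE] := g_lift _ (h \o g') g'_pre.1.
by exists (l \o k) => m; rewrite -hE /= -kE; apply: lE.
Qed.

End PrecoverCompletingDomain.

Theorem proposition2p9 (R : pzRingType) (X : lmodType R -> Prop)
    (X_precovering : precovering X) (X_iso : iso_closed X)
    (X_sum : finite_sum_closed X) (X_summand : summand_closed X)
    (M : lmodType R) :
  [<-> exists (G : lmodType R) (i : {linear M -> G}), X G /\ pure_mono i;
       forall E : lmodType R,
         pure_injective E -> precover_completing_domain X M E;
       exists (PEM : lmodType R) (u : {linear M -> PEM}),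
         preenvelope (@pure_injective R) u /\
         precover_completing_domain X M PEM;
       forall N : lmodType R^c,
         precover_completing_domain X M (character_module N);
       forall P : lmodType R^c,
         rpure_projective P ->
         precover_completing_domain X M (character_module P)].
Proof.
have [P [i [P_pp i_pure]]] := pure_in_dual_of_pure_projective M.
tfae.
- by move=> [G [j [XG j_pure]]] E; apply: pure_mono_completing j_pure.
- move=> pi_dom; exists (character_module P), i.
  split; last exact/pi_dom/char_pure_injective.
  by split=> [|E f E_pi]; [exact: char_pure_injective | exact: E_pi].
- move=> [PEM [u [[_ u_ext] PEM_dom]]] N.
  by apply: completing_through PEM_dom => // f; apply/u_ext/char_pure_injective.
- by move=> char_dom Q _; apply: char_dom.
- move=> /(_ P P_pp) P_dom.
  have [G [g g_pre]] := X_precovering (character_module P).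
  have [h hE] := P_dom i _ _ g_pre.
  by exists G, h; split; [exact: g_pre.1 | exact: pure_mono_comp_inv hE i_pure].
Qed.
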